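(* Let $S$ be a right LCM monoid and $N\colon S\to\mathbb{N}^\times$ a generalized scale. Then $s\in S\setminus S_c$ satisfies $N_s\in\mathrm{Irr}\,N(S)$ if and only if for all $a\in S_c$ and $t,r\in S$, $sa=tr$ implies either $t\in S_c$ or $r\in S_c$.
   Context: $\mathbb{N}^\times$ denotes the multiplicative monoid of positive integers. A right LCM monoid is a left cancellative monoid $S$ (with unit) in which the intersection $sS\cap tS$ of any two principal right ideals is either empty or again a principal right ideal. For $s,t\in S$ write $s\Cap t$ if $sS\cap tS\neq\emptyset$, and $s\perp t$ otherwise. The core of $S$ is $S_c:=\{a\in S\mid a\Cap s\text{ for all }s\in S\}$. Elements $s,t\in S$ are core equivalent, $s\sim t$, if there are $a,b\in S_c$ with $sa=tb$; this is an equivalence relation. A generalized scale on $S$ is a nontrivial homomorphism (not identically $1$) $N\colon S\to\mathbb{N}^\times$, $s\mapsto N_s$, such that: (1) $|N^{-1}(n)/_\sim|=n$ for all $n\in N(S)$; (2) $N_s=N_t$ implies $s\sim t$ or $s\perp t$; (3) for all $s\in S$ and $n\in N(S)$ there exists $t\in N^{-1}(n)$ with $s\Cap t$. For a submonoid $\mathcal{N}\subset\mathbb{N}^\times$, $\mathrm{Irr}\,\mathcal{N}:=\{n\in\mathcal{N}\setminus\{1\}\mid n=k\ell\text{ for }k,\ell\in\mathcal{N}\Rightarrow k=1\text{ or }\ell=1\}$. *)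

(* Defs.v *)
From mathcomp Require Import all_boot.
From mathcomp Require Import boolp classical_sets functions cardinality.

Set Implicit Arguments.
Unset Strict Implicit.
Unset Printing Implicit Defensive.

Local Open Scope classical_set_scope.

(* Sets are classical sets throughout. A [monoidType] carries a choice
   structure on its elements, which is no restriction since every type has one
   in the presence of the classical axioms of [boolp]. *)

Section Definitions.
Variable S : monoidType.
Implicit Types (s t a b : S) (A : set S).

Definition principal_right_ideal s : set S := [set (s * x)%g | x in [set: S]].

(* [right_injective] is injectivity of every left translation. *)
Definition left_cancellative : Prop := right_injective (fun s t => (s * t)%g).

Definition right_LCM_monoid : Prop :=
  left_cancellative /\
  forall s t,
    principal_right_ideal s `&` principal_right_ideal t = set0 \/
    exists r, principal_right_ideal s `&` principal_right_ideal t
              = principal_right_ideal r.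

(* [Cap s t] and [perp s t] are written $s \Cap t$ and $s \perp t$ *)
Definition Cap s t : Prop :=
  principal_right_ideal s `&` principal_right_ideal t !=set0.

Definition perp s t : Prop := ~ Cap s t.

Definition core : set S := [set a | forall s, Cap a s].

Definition core_equiv s t : Prop :=
  exists a b, [/\ core a, core b & (s * a)%g = (t * b)%g].

(* The quotient A / ~, as the set of the classes of the relation restricted
   to A. *)
Definition core_quotient A : set (set S) :=
  [set A `&` [set t | core_equiv s t] | s in A].

(* The multiplicative monoid of positive integers is the set of the n : nat
   with 0 < n. *)
Record generalized_scale (N : S -> nat) : Prop := GeneralizedScale {
  scale_gt0 : forall s, (0 < N s)%N ;
  scale1 : N 1%g = 1%N ;
  scaleM : forall s t, N (s * t)%g = (N s * N t)%N ;
  scale_nontrivial : exists s, N s <> 1%N ;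
  scale_card : forall n, range N n ->
    (core_quotient (N @^-1` [set n]) #= `I_n)%card ;
  scale_equiv_or_perp : forall s t, N s = N t -> core_equiv s t \/ perp s t ;
  scale_Cap : forall s n, range N n -> exists2 t, N t = n & Cap s t }.

End Definitions.

Arguments core : clear implicits.

Definition Irr (M : set nat) : set nat :=
  [set n | [/\ M n, n <> 1%N &
     forall k l, M k -> M l -> n = (k * l)%N -> k = 1%N \/ l = 1%N]].

(* Main.v *)
Require Import Defs.
From mathcomp Require Import all_boot.
From mathcomp Require Import boolp classical_sets functions cardinality.

Local Open Scope classical_set_scope.

(* A generalized scale takes the value 1 exactly on the core. Hence an identity
   [s a = t r] with [a] in the core is, up to core elements, a factorization of
   [N s]. Conversely, a factorization [N s = k l] in the range of [N] lifts to
   such an identity: pick [t] of scale [k] with [s x = t y], then [r] of scale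
   [l] meeting [y]; so [t r] meets [s] and has the same scale, whence
   [t r ~ s]. *)

Lemma CapP (S : monoidType) (s t : S) :
  Cap s t <-> exists x y, (s * x)%g = (t * y)%g.
Proof.
split=> [[_ [[x _ <-] [y _ /esym e]]]|[x [y e]]]; first by exists x, y.
by exists (s * x)%g; split; [exists x|exists y].
Qed.

Section GeneralizedScale.
Set Implicit Arguments.
Unset Strict Implicit.
Variables (S : monoidType) (N : S -> nat).
Hypothesis hN : generalized_scale N.

Lemma core_equiv_of_Cap (s t : S) : N s = N t -> Cap s t -> core_equiv s t.
Proof. by move=> /(scale_equiv_or_perp hN)[]. Qed.

(** As [s] meets [1], the two are core equivalent: [s * a = b] with [b] in the core, so [s] meets
    whatever [b] meets. *)
Lemma core_of_scale_eq1 (s : S) : N s = 1%N -> core S s.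
Proof.
move=> Ns; have [||a [b [_ cb e]] t] := @core_equiv_of_Cap s 1%g.
- by rewrite Ns (scale1 hN).
- by apply/CapP; exists 1%g, s; rewrite mulg1 mul1g.
have /CapP[x [y exy]] := cb t.
by apply/CapP; exists (a * x)%g, y; rewrite mulgA e mul1g.
Qed.

(* An element of the core meets every element of its own scale [n], so all
   elements of scale [n] are equivalent and [n = 1]. *)
Lemma scale_eq1_of_core (a : S) : core S a -> N a = 1%N.
Proof.
move=> ca; set A := N @^-1` [set N a].
have equivA s t : A s -> A t -> core_equiv s t.
  rewrite /A /= => Ns Nt.
  have [u [v [cu _ es]]] := core_equiv_of_Cap (esym Ns) (ca s).
  have [u' [v' [_ _ et]]] := core_equiv_of_Cap (esym Nt) (ca t).
  apply: core_equiv_of_Cap; first by rewrite Ns Nt.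
  (* With [u * x = u' * y], the element [a * u * x] is a common right multiple of [s] and [t]. *)
  have /CapP[x [y exy]] := cu u'.
  apply/CapP; exists (v * x)%g, (v' * y)%g.
  by rewrite !mulgA -es -et -!mulgA exy.
have quotE : core_quotient A = [set A].
  have classE s : A s -> A `&` [set t | core_equiv s t] = A.
    by move=> As; apply/setIidPl => t; apply: equivA.
  apply/seteqP; split=> [_ [s As <-]|_ ->] /=; first exact: classE.
  by exists a => //; apply: classE.
have := scale_card hN (ex_intro2 _ _ a I erefl).
rewrite -/A quotE => /(card_eq_trans (card_esym card_set1)) /card_eq_II.
by move=> /esym.
Qed.

Lemma coreP (s : S) : core S s <-> N s = 1%N.
Proof. by split; [apply: scale_eq1_of_core|apply: core_of_scale_eq1]. Qed.

Lemma scale_factor_lift (s : S) (k l : nat) :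
  range N k -> range N l -> N s = (k * l)%N ->
  exists t r, [/\ N t = k, N r = l & core_equiv s (t * r)%g].
Proof.
move=> hk hl Ns.
have [t Nt /CapP[x [y e]]] := scale_Cap hN s hk.
have [r Nr /CapP[w [z e']]] := scale_Cap hN y hl.
exists t, r; split=> //; apply: core_equiv_of_Cap.
  by rewrite (scaleM hN) Nt Nr.
by apply/CapP; exists (x * w)%g, z; rewrite mulgA e -!mulgA e'.
Qed.

End GeneralizedScale.

Theorem proposition4p1 (S : monoidType) (hS : right_LCM_monoid S)
    (N : S -> nat) (hN : generalized_scale N) (s : S) (hs : ~ core S s) :
  Irr (range N) (N s) <->
  forall a t r : S, core S a -> (s * a)%g = (t * r)%g -> core S t \/ core S r.
Proof.
split=> [[_ _ irr] a t r /(coreP hN) Na /(congr1 N)|irr].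
  rewrite !(scaleM hN) Na muln1 => e; rewrite !(coreP hN).
  exact: irr.
split; [by exists s|by rewrite -(coreP hN)|move=> k l hk hl Ns].
have [t [r [<- <- [a [b [ca /(coreP hN) Nb e]]]]]] :=
  scale_factor_lift hN hk hl Ns.
(* The core element [b] is absorbed into the right factor, whose scale stays [N r] because
   [N b = 1]. *)
have := irr a t (r * b)%g ca; rewrite mulgA => /(_ e).
by rewrite !(coreP hN) (scaleM hN) Nb muln1.
Qed.
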